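(* Let $n\ge1$, $\alpha,\gamma,\beta_1,\dots,\beta_n\in\widehat{\mathbb{F}_q^\times}$, and $i\in\{0,1,\dots,n-1\}$. (i) If $\beta_{i+1}\cdots\beta_n\neq\varepsilon$, then for $\lambda_1,\dots,\lambda_i,x\in\mathbb{F}_q$, $$F_D^{(n)}\!\left({\alpha;\beta_1,\dots,\beta_n\atop\gamma};\lambda_1,\dots,\lambda_i,x,\dots,x\right)=F_D^{(i+1)}\!\left({\alpha;\beta_1,\dots,\beta_i,\beta_{i+1}\cdots\beta_n\atop\gamma};\lambda_1,\dots,\lambda_i,x\right).$$ In particular, if $\beta_1\cdots\beta_n\neq\varepsilon$, then $F_D^{(n)}\!\left({\alpha;\beta_1,\dots,\beta_n\atop\gamma};x,\dots,x\right)={}_2F_1\!\left({\alpha,\beta_1\cdots\beta_n\atop\gamma};x\right)$. (ii) If $\beta_{i+1}\cdots\beta_n\notin\{\varepsilon,\overline{\alpha}\gamma\}$, then for $\lambda_1,\dots,\lambda_i\in\mathbb{F}_q$, $$F_D^{(n)}\!\left({\alpha;\beta_1,\dots,\beta_n\atop\gamma};\lambda_1,\dots,\lambda_i,1,\dots,1\right)=\frac{g^\circ(\gamma)\,g(\overline{\alpha\beta_{i+1}\cdots\beta_n}\gamma)}{g^\circ(\overline{\alpha}\gamma)\,g^\circ(\overline{\beta_{i+1}\cdots\beta_n}\gamma)}F_D^{(i)}\!\left({\alpha;\beta_1,\dots,\beta_i\atop\overline{\beta_{i+1}\cdots\beta_n}\gamma};\lambda_1,\dots,\lambda_i\right).$$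 In particular, if $\beta_1\cdots\beta_n\notin\{\varepsilon,\overline{\alpha}\gamma\}$, then $F_D^{(n)}\!\left({\alpha;\beta_1,\dots,\beta_n\atop\gamma};1,\dots,1\right)=\frac{g^\circ(\gamma)g(\overline{\alpha\beta_1\cdots\beta_n}\gamma)}{g^\circ(\overline{\alpha}\gamma)g^\circ(\overline{\beta_1\cdots\beta_n}\gamma)}$.
   Context: $\mathbb{F}_q$ is a finite field with $q$ elements. $\widehat{\mathbb{F}_q^\times}$ is the group of multiplicative characters $\mathbb{F}_q^\times\to\overline{\mathbb{Q}}^\times$, $\varepsilon$ the trivial character; every character (including $\varepsilon$) is extended by $0$ at $0$; $\overline{\eta}=\eta^{-1}$, and $\overline{\eta_1\cdots\eta_k}=(\eta_1\cdots\eta_k)^{-1}$; $\delta(\eta)=1$ if $\eta=\varepsilon$, else $0$. $\psi$ is a fixed non-trivial additive character. $g(\eta)=-\sum_{x\in\mathbb{F}_q^\times}\psi(x)\eta(x)$, $g^\circ(\eta)=q^{\delta(\eta)}g(\eta)$, $(\alpha)_\nu=g(\alpha\nu)/g(\alpha)$, $(\alpha)^\circ_\nu=g^\circ(\alpha\nu)/g^\circ(\alpha)$. For $\lambda\in\mathbb{F}_q$, ${}_2F_1\!\left({\alpha,\beta\atop\gamma};\lambda\right)=\frac{1}{1-q}\sum_{\nu}\frac{(\alpha)_\nu(\beta)_\nu}{(\varepsilon)^\circ_\nu(\gamma)^\circ_\nu}\nu(\lambda)$. Lauricella's $F_D$: for $m\ge1$ and $\lambda_j\in\mathbb{F}_q$,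 $F_D^{(m)}\!\left({\alpha;\beta_1,\dots,\beta_m\atop\gamma};\lambda_1,\dots,\lambda_m\right)=\frac{1}{(1-q)^m}\sum_{\nu_1,\dots,\nu_m\in\widehat{\mathbb{F}_q^\times}}\frac{(\alpha)_{\nu_1\cdots\nu_m}\prod_j(\beta_j)_{\nu_j}}{(\gamma)^\circ_{\nu_1\cdots\nu_m}\prod_j(\varepsilon)^\circ_{\nu_j}}\prod_j\nu_j(\lambda_j)$, and by convention $F_D^{(0)}=1$. *)

(* Defs.v *)
From HB Require Import structures.
From mathcomp Require Import all_boot all_order all_algebra all_field.
From mathcomp Require Import classical_sets fsbigop.
Set Implicit Arguments. Unset Strict Implicit. Unset Printing Implicit Defensive.
Import Order.TTheory GRing.Theory Num.Theory.
Local Open Scope ring_scope.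

Section Defs.
Variable F : finFieldType.

(* maps F -> algC; multiplicative characters live here, extended by 0 at 0 *)
Definition chfun := {ffun F -> algC}.

Definition is_mchar (eta : chfun) : Prop :=
  [/\ eta 0 = 0, eta 1 = 1 &
      forall x y : F, x != 0 -> y != 0 -> eta (x * y) = eta x * eta y].

Definition is_nontriv_addchar (psi : F -> algC) : Prop :=
  [/\ forall x y : F, psi (x + y) = psi x * psi y,
      forall x : F, psi x != 0 & exists x : F, psi x != 1].

Definition qF : algC := (#|F|)%:R.

Definition eps : chfun := [ffun x => if x == 0 then 0 else 1].
Definition chmul (a b : chfun) : chfun := [ffun x => a x * b x].
(* inverse (= conjugate) character, overline eta; 0^-1 = 0 in mathcomp *)
Definition chinv (a : chfun) : chfun := [ffun x => (a x)^-1].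
Definition chprod (b : nat -> chfun) (m n : nat) : chfun :=
  [ffun x => if x == 0 then 0 else \prod_(m <= k < n) b k x].
Definition chprodI m (nu : {ffun 'I_m -> chfun}) : chfun :=
  [ffun x => if x == 0 then 0 else \prod_(j < m) nu j x].

Variable psi : F -> algC.

Definition gauss (eta : chfun) : algC :=
  - \sum_(x : F | x != 0) psi x * eta x.
Definition gaussc (eta : chfun) : algC :=
  (if eta == eps then qF else 1) * gauss eta.
Definition poch (a nu : chfun) : algC := gauss (chmul a nu) / gauss a.
Definition pochc (a nu : chfun) : algC := gaussc (chmul a nu) / gaussc a.

Definition F21 (a b c : chfun) (lam : F) : algC :=
  (1 - qF)^-1 *
  \sum_(nu \in (@is_mchar : chfun -> Prop))
     (poch a nu * poch b nu / (pochc eps nu * pochc c nu) * nu lam).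

Definition mchar_tuple m : {ffun 'I_m -> chfun} -> Prop :=
  fun nu => forall j, is_mchar (nu j).

(* Lauricella F_D^{(m)}(a; b_0..b_{m-1}; c; lam_0..lam_{m-1}),
   with the convention F_D^{(0)} = 1 *)
Definition FD (m : nat) (a : chfun) (b : nat -> chfun) (c : chfun)
    (lam : nat -> F) : algC :=
  if m is 0 then 1 else
  (1 - qF) ^- m *
  \sum_(nu \in @mchar_tuple m)
     (poch a (chprodI nu) * \prod_(j < m) poch (b j) (nu j)
      / (pochc c (chprodI nu) * \prod_(j < m) pochc eps (nu j))
      * \prod_(j < m) nu j (lam j)).
End Defs.

(* Main.v *)
Require Import Defs.
From HB Require Import structures.
From mathcomp Require Import all_boot all_order all_algebra all_field.
From mathcomp Require Import cyclic boolp classical_sets fsbigop ring.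
Import Order.TTheory GRing.Theory Num.Theory.
Local Open Scope ring_scope.

(** Detecting the product character [nu_1 ... nu_m] by orthogonality turns [F_D]
    into a finite-field Euler integral
      [F_D = \sum_(t != 0) K(t) \prod_j 1F0(beta_j; t * lambda_j)],
    where [K] depends only on [alpha] and [gamma], and [1F0(beta; x)] equals
    [beta (1 - x) ^ -1] except at [x = 0], or at [x = 1] when [beta] is trivial.
    The factors with equal [lambda_j] therefore multiply to a single [1F0], which is (i).
    For (ii), [K(t)] is a constant multiple of
    [alpha t * (alpha ^ -1 * gamma) (1 - t)] (except at [t = 1] when [alpha = gamma]),
    so that multiplying it by [1F0(beta; t)] only replaces [gamma] by [beta ^ -1 * gamma]
    and changes the constant. *)

(** * Multiplicative characters of a finite field *)

Section Characters.
Set Implicit Arguments.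
Unset Strict Implicit.
Variable F : finFieldType.
Implicit Types (chi mu a b c : chfun F) (x y t : F).

Lemma mchar0 {chi} : is_mchar chi -> chi 0 = 0.
Proof. by case. Qed.

Lemma mchar1 {chi} : is_mchar chi -> chi 1 = 1.
Proof. by case. Qed.

(** The value [0] at [0] removes the side conditions: both sides vanish as soon as one argument
    does. *)
Lemma mcharM {chi} : is_mchar chi -> {morph chi : x y / x * y}.
Proof.
case=> chi0 _ chiM x y.
have [->|x0] := eqVneq x 0; first by rewrite !mul0r chi0 mul0r.
have [->|y0] := eqVneq y 0; first by rewrite !mulr0 chi0 mulr0.
exact: chiM.
Qed.

Lemma mchar_neq0 {chi} : is_mchar chi -> forall x, x != 0 -> chi x != 0.
Proof.
move=> hchi x x0; apply/eqP => chix0.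
have := mchar1 hchi; rewrite -(divff x0) (mcharM hchi) chix0 mul0r.
by move/esym/eqP; rewrite oner_eq0.
Qed.

Lemma mcharV {chi} : is_mchar chi -> {morph chi : x / x^-1}.
Proof.
move=> hchi x; have [->|x0] := eqVneq x 0; first by rewrite !(invr0, mchar0 hchi).
apply: (mulfI (mchar_neq0 hchi x0)).
by rewrite -(mcharM hchi) !divff ?(mchar1 hchi) ?mchar_neq0.
Qed.

Lemma mcharN1 {chi} : is_mchar chi -> chi (-1) * chi (-1) = 1.
Proof. by move=> hchi; rewrite -(mcharM hchi) mulrNN mulr1 mchar1. Qed.

Lemma mcharE {a b} :
  is_mchar a -> is_mchar b -> (forall x, x != 0 -> a x = b x) -> a = b.
Proof.
move=> ha hb ab; apply/ffunP => x.
by have [->|/ab//] := eqVneq x 0; rewrite (mchar0 ha) (mchar0 hb).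
Qed.

Lemma eps_mchar : is_mchar (eps F).
Proof.
split=> [||x y x0 y0]; rewrite !ffunE ?eqxx ?oner_eq0 //.
by rewrite mulf_eq0 (negPf x0) (negPf y0) mulr1.
Qed.

Lemma chmul_mchar a b : is_mchar a -> is_mchar b -> is_mchar (chmul a b).
Proof.
move=> ha hb; split=> [||x y _ _]; rewrite !ffunE.
- by rewrite (mchar0 ha) mul0r.
- by rewrite (mchar1 ha) (mchar1 hb) mulr1.
- by rewrite (mcharM ha) (mcharM hb) mulrACA.
Qed.

Lemma chinv_mchar a : is_mchar a -> is_mchar (chinv a).
Proof.
move=> ha; split=> [||x y _ _]; rewrite !ffunE.
- by rewrite (mchar0 ha) invr0.
- by rewrite (mchar1 ha) invr1.
- by rewrite (mcharM ha) invfM.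
Qed.

Lemma chprod_mchar (b : nat -> chfun F) m n :
  (forall k, (m <= k < n)%N -> is_mchar (b k)) -> is_mchar (chprod b m n).
Proof.
move=> hb; split=> [||x y x0 y0]; rewrite !ffunE ?eqxx ?oner_eq0 //.
  by rewrite big_nat big1 // => k /hb /mchar1.
rewrite mulf_eq0 (negPf x0) (negPf y0) -big_split /= !big_nat.
by apply: eq_bigr => k /hb /mcharM.
Qed.

Lemma chprodI_mchar m (nu : {ffun 'I_m -> chfun F}) :
  mchar_tuple nu -> is_mchar (chprodI nu).
Proof.
move=> hnu; split=> [||x y x0 y0]; rewrite !ffunE ?eqxx ?oner_eq0 //.
  by rewrite big1 // => k _; exact: mchar1.
rewrite mulf_eq0 (negPf x0) (negPf y0) -big_split /=.
by apply: eq_bigr => k _; exact: mcharM.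
Qed.

Lemma chmul_eps a : is_mchar a -> chmul a (eps F) = a.
Proof.
move=> ha; apply: mcharE => //; first exact: (chmul_mchar ha eps_mchar).
by move=> x x0; rewrite !ffunE (negPf x0) mulr1.
Qed.

Lemma chmul_inv_eq_eps a b :
  is_mchar a -> is_mchar b -> (chmul a (chinv b) == eps F) = (a == b).
Proof.
move=> ha hb; apply/eqP/eqP => [/ffunP ab|->]; apply: mcharE => //.
- move=> x x0; have := ab x; rewrite !ffunE (negPf x0) => /(congr1 ( *%R^~ (b x))).
  by rewrite mulfVK ?mul1r // mchar_neq0.
- exact: (chmul_mchar hb (chinv_mchar hb)).
- exact: eps_mchar.
- by move=> x x0; rewrite !ffunE (negPf x0) divff // mchar_neq0.
Qed.

Lemma sum_scale (V : nmodType) (f : F -> V) y : y != 0 ->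
  \sum_(x | x != 0) f (x * y) = \sum_(x | x != 0) f x.
Proof.
move=> y0; symmetry; rewrite (reindex_onto ( *%R^~ y) ( *%R^~ y^-1)) /=.
  by apply: eq_bigl => x; rewrite mulfK // eqxx andbT mulf_eq0 negb_or y0 andbT.
by move=> x _; rewrite mulfVK.
Qed.

Lemma sum_mchar_eq0 chi :
  is_mchar chi -> chi != eps F -> \sum_(x | x != 0) chi x = 0.
Proof.
move=> hchi /eqP chi1.
have [y /andP[y0 chiy]|none] := pickP [pred y | (y != 0) && (chi y != 1)].
  (* Scaling the summation variable by [y] multiplies the sum by [chi y], which is not [1]. *)
  have : (chi y - 1) * \sum_(x | x != 0) chi x = 0.
    rewrite mulrBl mul1r mulr_sumr -[X in _ - X](sum_scale _ y0).
    by apply/eqP; rewrite subr_eq0; apply/eqP/eq_bigr => x _; rewrite mcharM // mulrC.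
  by move/eqP; rewrite mulf_eq0 subr_eq0 (negPf chiy) => /eqP.
case: chi1; apply: mcharE => //; first exact: eps_mchar.
by move=> x x0; have /= := none x; rewrite x0 ffunE (negPf x0) => /negbT/negPn/eqP.
Qed.

Lemma card_neq0 : #|[pred x : F | x != 0]| = #|F|.-1.
Proof. exact: (cardC1 (0 : F)). Qed.

Lemma cardF_gt1 : (1 < #|F|)%N.
Proof. by rewrite (cardD1 0) (cardD1 1) !inE oner_eq0. Qed.

Lemma qF_neq0 : qF F != 0.
Proof. by rewrite pnatr_eq0 -lt0n ltnW // cardF_gt1. Qed.

Lemma qF_predE : (#|F|.-1)%:R = qF F - 1.
Proof. by rewrite -subn1 natrB // ltnW // cardF_gt1. Qed.

Lemma qF_sub1_neq0 : qF F - 1 != 0.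
Proof. by rewrite -qF_predE pnatr_eq0 -lt0n; have := cardF_gt1; case: #|F| => [|[]]. Qed.

(** Orthogonality of characters, with [t^-1] in one argument because [FDker] is expanded in
    characters of [t^-1]. *)
Lemma sum_chinv_mchar chi mu : is_mchar chi -> is_mchar mu ->
  \sum_(t | t != 0) chi t^-1 * mu t = if chi == mu then qF F - 1 else 0.
Proof.
move=> hchi hmu; rewrite eq_sym -chmul_inv_eq_eps //.
have -> : \sum_(t | t != 0) chi t^-1 * mu t = \sum_(t | t != 0) chmul mu (chinv chi) t.
  by apply: eq_bigr => t _; rewrite !ffunE mcharV // mulrC.
case: ifPn => [/eqP ->|ne]; last first.
  by rewrite sum_mchar_eq0 //; apply: chmul_mchar => //; exact: chinv_mchar.
rewrite -qF_predE -card_neq0 -sum1_card natr_sum.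
by apply: eq_bigr => t t0; rewrite ffunE (negPf t0).
Qed.

(** * Enumeration of the characters, and sums over all of them *)

Lemma expf_card_pred x : x != 0 -> x ^+ #|F|.-1 = 1.
Proof.
move=> x0; apply: (mulfI x0); rewrite -exprS prednK ?mulr1 ?expf_card //.
by rewrite ltnW // cardF_gt1.
Qed.

Lemma cardF_pred_gt0 : (0 < #|F|.-1)%N.
Proof. by have := cardF_gt1; case: #|F| => [|[]]. Qed.

Lemma prim_elt_subproof : exists w : F, (#|F|.-1).-primitive_root w.
Proof.
have /hasP[w _ hw] : has (#|F|.-1).-primitive_root (enum [pred x : F | x != 0]).
  apply: cyclic.has_prim_root; rewrite ?cardF_pred_gt0 ?enum_uniq -?cardE ?card_neq0 //.
  by apply/allP => x; rewrite mem_enum inE => x0; rewrite unity_rootE expf_card_pred.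
by exists w.
Qed.

Definition prim_elt : F := sval (sigW prim_elt_subproof).

Lemma prim_eltP : (#|F|.-1).-primitive_root prim_elt.
Proof. by rewrite /prim_elt; case: sigW. Qed.

Definition prim_root_q1 : algC := sval (C_prim_root_exists cardF_pred_gt0).

Lemma prim_root_q1P : (#|F|.-1).-primitive_root prim_root_q1.
Proof. by rewrite /prim_root_q1; case: C_prim_root_exists. Qed.

Definition dlog x : nat := odflt 0%N (omap val [pick i : 'I_#|F|.-1 | prim_elt ^+ i == x]).

Lemma dlogK x : x != 0 -> prim_elt ^+ dlog x = x.
Proof.
move=> x0; rewrite /dlog; case: pickP => [i /eqP|none] //=.
have [i xE] := prim_rootP prim_eltP (expf_card_pred x0).
by have := none i; rewrite -xE eqxx.
Qed.

(** The character sending the generator [prim_elt] to [prim_root_q1 ^+ k]. The ambient type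
    [chfun F] is infinite; this indexing by a finite type allows ordinary big sums. *)
Definition mchr (k : 'I_#|F|.-1) : chfun F :=
  [ffun x => if x == 0 then 0 else prim_root_q1 ^+ (k * dlog x)].

(** The discrete logarithm is additive only modulo [#|F|.-1], which suffices because [prim_root_q1]
    has exactly that order. *)
Lemma mchr_mchar k : is_mchar (mchr k).
Proof.
split=> [||x y x0 y0]; rewrite !ffunE ?eqxx ?oner_eq0 //.
  apply/eqP; rewrite -(expr0 prim_root_q1) (eq_prim_root_expr prim_root_q1P) -modnMmr.
  suff /eqP -> : (dlog 1%R == 0 %[mod #|F|.-1])%N by rewrite mod0n muln0 mod0n.
  by rewrite -(eq_prim_root_expr prim_eltP) dlogK ?oner_eq0 ?expr0.
rewrite mulf_eq0 (negPf x0) (negPf y0) -exprD -mulnDr.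
apply/eqP; rewrite (eq_prim_root_expr prim_root_q1P) -modnMmr.
suff /eqP -> : (dlog (x * y)%R == dlog x + dlog y %[mod #|F|.-1])%N by rewrite modnMmr.
by rewrite -(eq_prim_root_expr prim_eltP) exprD !dlogK ?mulf_neq0.
Qed.

Lemma prim_elt_neq0 : prim_elt != 0.
Proof. by rewrite (prim_root_eq0 prim_eltP) -lt0n cardF_pred_gt0. Qed.

Lemma mcharX chi x n : is_mchar chi -> chi (x ^+ n) = chi x ^+ n.
Proof.
move=> hchi; elim: n => [|n IHn]; first by rewrite !expr0 mchar1.
by rewrite !exprS mcharM // IHn.
Qed.

Lemma mchr_prim_elt k : mchr k prim_elt = prim_root_q1 ^+ k.
Proof.
rewrite ffunE (negPf prim_elt_neq0); apply/eqP.
rewrite (eq_prim_root_expr prim_root_q1P) -modnMmr.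
suff /eqP -> : (dlog prim_elt == 1 %[mod #|F|.-1])%N by rewrite modnMmr muln1.
by rewrite -(eq_prim_root_expr prim_eltP) dlogK ?prim_elt_neq0 ?expr1.
Qed.

Lemma mchr_inj : injective mchr.
Proof.
move=> k l /ffunP/(_ prim_elt); rewrite !mchr_prim_elt => /eqP.
by rewrite (eq_prim_root_expr prim_root_q1P) !modn_small // => /eqP/val_inj.
Qed.

(** A character is determined by its value at the generator, a root of unity of order dividing
    [#|F|.-1]. The informative existential lets an index be extracted for every entry of a tuple of
    characters. *)
Lemma mchr_surj chi : is_mchar chi -> {k | chi = mchr k}.
Proof.
move=> hchi; have [|k kE] := @prim_rootP _ _ _ prim_root_q1P (chi prim_elt).
  by rewrite -(mcharX _ _ hchi) (prim_expr_order prim_eltP) mchar1.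
exists k; apply: mcharE => //; first exact: mchr_mchar.
move=> x x0; rewrite -(dlogK x0) (mcharX _ _ hchi) (mcharX _ _ (mchr_mchar k)).
by rewrite mchr_prim_elt kE.
Qed.

(** Dual orthogonality: for [x] other than [0] and [1] this is a full geometric sum whose ratio [z]
    is a root of unity different from [1]. *)
Lemma sum_mchr x :
  \sum_k mchr k x = if x == 1 then qF F - 1 else 0.
Proof.
have [->|x1] := eqVneq.
  rewrite -qF_predE; under eq_bigr do rewrite (mchar1 (mchr_mchar _)).
  by rewrite sumr_const card_ord.
have [->|x0] := eqVneq x 0.
  by rewrite big1 // => k _; exact: (mchar0 (mchr_mchar k)).
set z := prim_root_q1 ^+ dlog x.
have -> : \sum_k mchr k x = \sum_(k < #|F|.-1) z ^+ k.
  by apply: eq_bigr => k _; rewrite ffunE (negPf x0) -exprM mulnC.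
have z1 : z - 1 != 0.
  rewrite subr_eq0 -(expr0 prim_root_q1) (eq_prim_root_expr prim_root_q1P).
  by rewrite -(eq_prim_root_expr prim_eltP) dlogK ?expr0.
apply: (mulfI z1); rewrite -subrX1 mulr0 exprAC.
by rewrite (prim_expr_order prim_root_q1P) expr1n subrr.
Qed.

(** Bridge from the finitely supported sums over a set in the definitions to big sums over a finite
    type, for single characters and for tuples alike. *)
Lemma fsum_enum (I : finType) (T : choiceType) (V : nmodType) (h : I -> T)
    (P : T -> Prop) (f : T -> V) :
  injective h -> (forall i, P (h i)) -> (forall u, P u -> exists i, u = h i) ->
  \sum_(u \in (P : set T)) f u = \sum_i f (h i).
Proof.
move=> hinj Ph hP; rewrite (fsbigE [seq h i | i <- enum I]).
- by rewrite big_map big_enum_cond; apply: eq_bigl => i; apply/asboolP.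
- by rewrite map_inj_uniq // enum_uniq.
- by move=> _ /mapP[i _ ->].
- by move=> u /hP[i ->]; rewrite map_f // mem_enum.
Qed.

Lemma fsum_mchar (f : chfun F -> algC) :
  \sum_(chi \in (@is_mchar F : set _)) f chi = \sum_k f (mchr k).
Proof.
apply: (fsum_enum _ mchr_inj mchr_mchar) => chi /mchr_surj[k ->].
by exists k.
Qed.

Lemma fsum_mchar_tuple m (f : {ffun 'I_m -> chfun F} -> algC) :
  \sum_(nu \in (@mchar_tuple F m : set _)) f nu =
  \sum_(k : {ffun 'I_m -> 'I_#|F|.-1}) f [ffun j => mchr (k j)].
Proof.
apply: (fsum_enum (h := fun k : {ffun 'I_m -> 'I_#|F|.-1} => [ffun j => mchr (k j)])).
- move=> k l /ffunP kl; apply/ffunP => j; apply: mchr_inj.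
  by have := kl j; rewrite !ffunE.
- by move=> k j; rewrite ffunE; exact: mchr_mchar.
- move=> nu hnu; exists [ffun j => sval (mchr_surj (hnu j))].
  by apply/ffunP => j; rewrite !ffunE; case: mchr_surj.
Qed.

End Characters.

(** * Gauss sums and one-variable character sums of their quotients *)

Section GaussSums.
Set Implicit Arguments.
Unset Strict Implicit.
Variables (F : finFieldType) (psi : F -> algC).
Hypothesis hpsi : is_nontriv_addchar psi.
Implicit Types (chi mu a b c : chfun F) (x y t s : F).

Local Notation q := (qF F).
Local Notation g := (gauss psi).
Local Notation gc := (gaussc psi).
Local Notation eps := (eps F).

Lemma chmulE a b x : chmul a b x = a x * b x.
Proof. by rewrite ffunE. Qed.

Lemma chinvE a x : chinv a x = (a x)^-1.
Proof. by rewrite ffunE. Qed.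

Let psiD x y : psi (x + y) = psi x * psi y.
Proof. by case: hpsi. Qed.

Let psi0 : psi 0 = 1.
Proof.
have [_ /(_ 0) psi0 _] := hpsi.
by apply: (mulfI psi0); rewrite -psiD addr0 mulr1.
Qed.

Lemma sum_addchar : \sum_(x | x != 0) psi x = -1.
Proof.
have [_ _ [y psiy]] := hpsi.
suff : \sum_x psi x = 0 by rewrite (bigD1 0) //= psi0 => /eqP; rewrite addrC addr_eq0 => /eqP.
have : (psi y - 1) * \sum_x psi x = 0.
  rewrite mulrBl mul1r mulr_sumr [X in _ - X](reindex_inj (addrI y)) /=.
  by under eq_bigr do rewrite -psiD; rewrite subrr.
by move/eqP; rewrite mulf_eq0 subr_eq0 (negPf psiy) => /eqP.
Qed.

Lemma gauss_eps : g eps = 1.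
Proof.
rewrite /gauss -[RHS]opprK -sum_addchar; congr (- _).
by apply: eq_bigr => x x0; rewrite ffunE (negPf x0) mulr1.
Qed.

Lemma gaussc_eps : gc eps = q.
Proof. by rewrite /gaussc eqxx gauss_eps mulr1. Qed.

Lemma gaussc_neq_eps chi : chi != eps -> gc chi = g chi.
Proof. by rewrite /gaussc => /negPf ->; rewrite mul1r. Qed.

(* At [s = 0] the right-hand side is [0] through the junk value [0^-1 = 0]. *)
Lemma sum_addchar_scale chi s : is_mchar chi -> (s != 0) || (chi != eps) ->
  \sum_(u | u != 0) psi (u * s) * chi u = - (chi s)^-1 * g chi.
Proof.
move=> hchi; have [-> /= chi1|s0 _] := eqVneq s 0.
  rewrite mchar0 // invr0 oppr0 mul0r -[RHS](sum_mchar_eq0 hchi chi1).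
  by apply: eq_bigr => u _; rewrite mulr0 psi0 mul1r.
rewrite mulNr -mulrN /gauss opprK -[in RHS](sum_scale _ s0) mulr_sumr.
apply: eq_bigr => u _; rewrite (mcharM hchi).
by field; exact: mchar_neq0.
Qed.

(** The reflection formula; the factor [q] in [gc eps] makes it hold for the trivial character too.
    Otherwise, replacing [v] by [v * u] in the double sum leaves [psi (u * (1 + v))], whose sum over
    [u] is [q - 1] at [v = -1] and [-1] elsewhere. *)
Lemma gaussc_gauss_inv chi : is_mchar chi -> gc chi * g (chinv chi) = chi (-1) * q.
Proof.
move=> hchi; have [->|chi1] := eqVneq chi eps.
  rewrite gaussc_eps [chinv eps](_ : _ = eps); last first.
    by apply/ffunP => x; rewrite !ffunE; case: ifP; rewrite ?invr0 ?invr1.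
  by rewrite gauss_eps mulrC ffunE oppr_eq0 oner_eq0.
rewrite gaussc_neq_eps // /gauss mulrNN mulr_suml.
under eq_bigr => u u0.
  rewrite mulr_sumr -(sum_scale _ u0).
  under eq_bigr => v v0.
    rewrite chinvE (mcharM hchi) [_ * _](_ : _ = (chi v)^-1 * psi (u * (1 + v))); last first.
      rewrite mulrDr mulr1 psiD [v * u]mulrC.
      by field; rewrite !mchar_neq0.
    over.
  over.
rewrite exchange_big /= (bigD1 (-1)) ?oppr_eq0 ?oner_eq0 //=.
rewrite -mulr_sumr [X in _ * X](eq_bigr (fun=> 1)); last by move=> u _; rewrite subrr mulr0 psi0.
rewrite sumr_const card_neq0 qF_predE -(mcharV hchi) invrN1.
rewrite (eq_bigr (fun v => - (chinv chi) v)); last first.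
  move=> v /andP[v0 v1]; rewrite -mulr_sumr chinvE -[RHS]mulrN1; congr (_ * _).
  rewrite (sum_scale psi) ?sum_addchar // addrC addr_eq0; exact: v1.
(* Since [chinv chi] is non-trivial, its values off [-1] sum to minus its value at [-1]. *)
have := sum_mchar_eq0 (chinv_mchar hchi); rewrite (bigD1 (-1)) ?oppr_eq0 ?oner_eq0 //=.
rewrite sumrN chinvE -(mcharV hchi) invrN1 => E.
rewrite -[X in _ - X](addKr (chi (-1))) E; first by rewrite mulrBr; ring.
apply: contraNneq chi1 => E1; rewrite eq_sym -chmul_inv_eq_eps //; last exact: eps_mchar.
by rewrite E1 chmul_eps //; exact: eps_mchar.
Qed.

Lemma gauss_neq0 chi : is_mchar chi -> g chi != 0.
Proof.
move=> hchi; have [->|chi1] := eqVneq chi eps; first by rewrite gauss_eps oner_eq0.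
have /eqP := gaussc_gauss_inv hchi; rewrite gaussc_neq_eps //.
apply: contraTneq => ->; rewrite mul0r eq_sym mulf_eq0 negb_or qF_neq0 andbT.
by rewrite mchar_neq0 // oppr_eq0 oner_eq0.
Qed.

Lemma gaussc_neq0 chi : is_mchar chi -> gc chi != 0.
Proof.
move=> hchi; rewrite /gaussc mulf_neq0 ?gauss_neq0 //.
by case: ifP => _; rewrite ?qF_neq0 ?oner_eq0.
Qed.

(** Expanding both Gauss sums over [u] and [v], the sum over characters selects [v = u * y], so a
    single sum over [u] remains. *)
Lemma sum_gauss_gauss_inv a b y : is_mchar a -> is_mchar b -> y != 0 ->
  \sum_k g (chmul a (mchr k)) * g (chinv (chmul b (mchr k))) * mchr k y =
  (q - 1) * (b y)^-1 * \sum_(u | u != 0) psi (u * (1 + y)) * chmul a (chinv b) u.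
Proof.
move=> ha hb y0.
transitivity (\sum_k \sum_(u | u != 0) \sum_(v | v != 0)
   psi (u + v) * a u / b v * mchr k (u * y / v)).
  apply: eq_bigr => k _; have hk := mchr_mchar k.
  rewrite /gauss mulrNN mulr_suml mulr_suml; apply: eq_bigr => u u0.
  rewrite mulr_sumr mulr_suml; apply: eq_bigr => v v0.
  rewrite chinvE !chmulE psiD !(mcharM hk) (mcharV hk).
  by field; rewrite !mchar_neq0.
rewrite exchange_big mulr_sumr; apply: eq_bigr => u u0 /=.
rewrite exchange_big (bigD1 (u * y)) ?mulf_neq0 //= [X in _ + X]big1 ?addr0; last first.
  move=> v /andP[v0 vu]; rewrite -mulr_sumr sum_mchr ifF ?mulr0 //.
  apply: contraNF vu => /eqP E; apply/eqP.
  by apply: (mulIf (invr_neq0 v0)); rewrite divff // E.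
rewrite -mulr_sumr divff ?mulf_neq0 // sum_mchr eqxx chmulE chinvE (mcharM hb).
by rewrite [u * (1 + y)]mulrDr mulr1; field; rewrite !mchar_neq0.
Qed.

(* [q / gc chi = chi (-1) * g (chinv chi)] turns the quotients of Gauss sums into products. *)
Lemma sum_poch a b y : is_mchar a -> is_mchar b -> y != 0 -> (y != 1) || (a != b) ->
  \sum_k poch psi a (mchr k) / pochc psi b (mchr k) * mchr k y =
  (1 - q) * gc b * g (chmul a (chinv b)) / (g a * q) * (b (1 - y) / (a (1 - y) * b y)).
Proof.
move=> ha hb y0 hy.
have hab := chmul_mchar ha (chinv_mchar hb).
have m1 : -1 != 0 :> F by rewrite oppr_eq0 oner_eq0.
(* The sign [mchr k (-1)] from the reflection formula moves the argument from [y] to [- y], so that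
   [1 - y] appears. *)
transitivity (gc b / (g a * q) * b (-1) * \sum_k
   g (chmul a (mchr k)) * g (chinv (chmul b (mchr k))) * mchr k (- y)).
  rewrite mulr_sumr; apply: eq_bigr => k _; have hk := mchr_mchar k.
  have hbk := chmul_mchar hb hk.
  rewrite /poch /pochc -[- y]mulN1r (mcharM hk).
  have -> : g (chinv (chmul b (mchr k))) = b (-1) * mchr k (-1) * q / gc (chmul b (mchr k)).
    apply: (mulfI (gaussc_neq0 hbk)); rewrite gaussc_gauss_inv // chmulE.
    by field; exact: gaussc_neq0.
  have N1 := mcharN1 hb; have N2 := mcharN1 hk.
  rewrite [RHS](_ : _ = (b (-1) * b (-1)) * (mchr k (-1) * mchr k (-1)) *
    (g (chmul a (mchr k)) / g a / (gc (chmul b (mchr k)) / gc b) * mchr k y)).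
    by rewrite N1 N2 !mul1r.
  by field; rewrite !(gauss_neq0, gaussc_neq0, qF_neq0).
rewrite sum_gauss_gauss_inv ?oppr_eq0 // sum_addchar_scale //; last first.
  by rewrite subr_eq0 eq_sym chmul_inv_eq_eps.
rewrite chmulE chinvE [(a _ / _)^-1]invfM [(b _)^-1^-1]invrK.
have -> : b (- y) = b (-1) * b y by rewrite -(mcharM hb) mulN1r.
(* [a (1 - y)] is zero when [y = 1]; naming its inverse keeps [field] from requiring it to be
   nonzero. *)
rewrite [(a _ * b y)^-1]invfM; set z := (a (1 - y))^-1.
by field; rewrite qF_neq0 gauss_neq0 ?mchar_neq0.
Qed.

End GaussSums.

(** * Euler integrals for [FD] and [F21] *)

Section Lauricella.
Set Implicit Arguments.
Unset Strict Implicit.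
Variables (F : finFieldType) (psi : F -> algC).
Hypothesis hpsi : is_nontriv_addchar psi.
Implicit Types (chi mu a b c : chfun F) (x y t s : F).

Local Notation q := (qF F).
Local Notation g := (gauss psi).
Local Notation gc := (gaussc psi).
Local Notation eps := (eps F).

(* The hypergeometric function 1F0(b; x), the analogue of [(1 - x) ^ (- b)]. *)
Definition F10 b x : algC :=
  (1 - q)^-1 * \sum_k poch psi b (mchr k) / pochc psi eps (mchr k) * mchr k x.

(** The inverse Mellin transform over the multiplicative group of the quotient
    [poch psi a / pochc psi c]. *)
Definition FDker a c t : algC :=
  (q - 1)^-1 * \sum_k poch psi a (mchr k) / pochc psi c (mchr k) * mchr k t^-1.

Lemma F10_0 b : F10 b 0 = 0.
Proof.
by rewrite /F10 big1 ?mulr0 // => k _; rewrite (mchar0 (mchr_mchar k)) mulr0.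
Qed.

Lemma q1_neq0 : 1 - q != 0.
Proof. by rewrite -opprB oppr_eq0 qF_sub1_neq0. Qed.

(** This is [sum_poch] with [eps] as lower parameter. At [x = 1] both sides are [0], the right one
    through [0^-1 = 0]. *)
Lemma F10E b x : is_mchar b -> x != 0 -> (x != 1) || (b != eps) ->
  F10 b x = (b (1 - x))^-1.
Proof.
move=> hb x0 hx; rewrite /F10 (sum_poch hpsi hb (eps_mchar F) x0 hx).
have -> : chmul b (chinv eps) = b.
  apply: mcharE => //; first exact: chmul_mchar hb (chinv_mchar (eps_mchar F)).
  by move=> y y0; rewrite chmulE chinvE ffunE (negPf y0) divr1.
rewrite gaussc_eps // [eps x]ffunE (negPf x0) ffunE subr_eq0 eq_sym mulr1.
have [x1|x1] := eqVneq x 1.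
  by rewrite x1 subrr (mchar0 hb) invr0 !(mul0r, mulr0).
by field; rewrite q1_neq0 qF_neq0 gauss_neq0 ?mchar_neq0 // subr_eq0 eq_sym.
Qed.

(** This is [sum_poch] at [t^-1], where [1 - t^-1 = - (1 - t) / t]. The signs from this and from the
    reflection formula for [chmul (chinv a) c] cancel, as [a (-1)] and [c (-1)] square to [1]. *)
Lemma FDkerE a c t : is_mchar a -> is_mchar c -> t != 0 -> (t != 1) || (a != c) ->
  FDker a c t = - gc c / (g a * gc (chmul (chinv a) c)) * (a t * c (1 - t) / a (1 - t)).
Proof.
move=> ha hc t0 ht; rewrite /FDker sum_poch ?invr_eq0 ?invr_eq1 //.
have hac := chmul_mchar (chinv_mchar ha) hc.
have acE : chinv (chmul (chinv a) c) = chmul a (chinv c).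
  by apply/ffunP => x; rewrite !(chmulE, chinvE) invfM invrK.
have m1 : -1 != 0 :> F by rewrite oppr_eq0 oner_eq0.
have -> : g (chmul a (chinv c)) = c (-1) / a (-1) * q / gc (chmul (chinv a) c).
  apply: (mulfI (gaussc_neq0 hpsi hac)); rewrite -acE gaussc_gauss_inv //.
  by rewrite chmulE chinvE; field; rewrite gaussc_neq0 // mchar_neq0.
have tE : 1 - t^-1 = (-1) * (1 - t) / t by field.
rewrite tE !(mcharM ha) !(mcharM hc) !(mcharV ha) !(mcharV hc).
have ct := mchar_neq0 hc t0; have at0 := mchar_neq0 ha t0.
have [E|E] := eqVneq (1 - t) 0.
  by rewrite E (mchar0 hc) !(mulr0, mul0r).
have N1 := mcharN1 hc; have N2 := mcharN1 ha.
rewrite [RHS](_ : _ = (c (-1) * c (-1)) / (a (-1) * a (-1)) *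
   (- gc c / (g a * gc (chmul (chinv a) c)) * (a t * c (1 - t) / a (1 - t)))); last first.
  by rewrite N1 N2 divr1 mul1r.
by field; rewrite !(qF_neq0, qF_sub1_neq0, gaussc_neq0, gauss_neq0) ?mchar_neq0.
Qed.

(** Mellin inversion: orthogonality keeps only the term of the kernel indexed by [mu]. *)
Lemma sum_FDker a c mu : is_mchar mu ->
  \sum_(t | t != 0) FDker a c t * mu t = poch psi a mu / pochc psi c mu.
Proof.
move=> hmu; have [k0 ->] := mchr_surj hmu.
rewrite /FDker; under eq_bigr => t _ do rewrite -mulrA mulr_suml.
rewrite -mulr_sumr exchange_big /= (bigD1 k0) //= [X in _ * (_ + X)]big1 ?addr0.
  under eq_bigr do rewrite -mulrA.
  rewrite -mulr_sumr sum_chinv_mchar; try exact: mchr_mchar.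
  by rewrite eqxx mulrCA mulVf ?mulr1 // qF_sub1_neq0.
move=> k kk0; under eq_bigr do rewrite -mulrA.
rewrite -mulr_sumr sum_chinv_mchar; try exact: mchr_mchar.
by rewrite (inj_eq (@mchr_inj F)) (negPf kk0) mulr0.
Qed.

(* [F_D] as a finite-field Euler integral; the case [m = 0] is the convention [F_D^(0) = 1]. *)
Lemma FD_sum m a (b : nat -> chfun F) c (lam : nat -> F) :
  is_mchar a -> is_mchar c ->
  FD psi m a b c lam =
  \sum_(t | t != 0) FDker a c t * \prod_(0 <= j < m) F10 (b j) (t * lam j).
Proof.
move=> ha hc; case: m => [|m].
  (* With no [F10] factor the integral is the Mellin transform at [eps], where the quotient of
     Pochhammer symbols is [1]. *)
  transitivity (\sum_(t | t != 0) FDker a c t * eps t).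
    rewrite sum_FDker; last exact: eps_mchar.
    by rewrite /poch /pochc !chmul_eps // !divff ?oner_eq0 //;
      [exact: gaussc_neq0|exact: gauss_neq0].
  by apply: eq_bigr => t t0; rewrite big_geq // ffunE (negPf t0).
rewrite /FD fsum_mchar_tuple.
under [RHS]eq_bigr => t t0.
  rewrite big_mkord /F10 big_split /= prodr_const card_ord bigA_distr_bigA /= mulrCA mulr_sumr.
  over.
rewrite -mulr_sumr exprVn; congr (_ * _); rewrite exchange_big /=.
apply: eq_bigr => k _; set nu := [ffun j => _].
have hnu : mchar_tuple nu by move=> j; rewrite ffunE; exact: mchr_mchar.
(* Only the factor in the product character couples the [nu j]; written as an integral over [t], it
   splits into the values [nu j t]. *)
rewrite invfM mulrACA -prodf_div -(sum_FDker _ _ (chprodI_mchar hnu)).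
rewrite -!mulrA !mulr_suml; apply: eq_bigr => t t0.
rewrite -mulrA; congr (FDker a c t * _).
rewrite ffunE (negPf t0) -!big_split /=; apply: eq_bigr => j _.
by rewrite ffunE (mcharM (mchr_mchar _)) mulrCA !mulrA.
Qed.

Lemma F21_sum a b c x :
  F21 psi a b c x = \sum_(t | t != 0) FDker a c t * F10 b (t * x).
Proof.
rewrite /F21 fsum_mchar /F10.
under [RHS]eq_bigr => t t0.
  rewrite mulrCA mulr_sumr; over.
rewrite -mulr_sumr; congr (_ * _); rewrite exchange_big /=.
apply: eq_bigr => k _; have hk := mchr_mchar k.
rewrite invfM [LHS](_ : _ = poch psi a (mchr k) / pochc psi c (mchr k) *
  (poch psi b (mchr k) / pochc psi eps (mchr k) * mchr k x)); last by ring.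
rewrite -(sum_FDker _ _ hk) mulr_suml.
by apply: eq_bigr => t t0; rewrite (mcharM hk); ring.
Qed.

(** For [x] other than [0] and [1] this is multiplicativity of the powers of [1 - x]. At [x = 0]
    both sides vanish because the range is nonempty; at [x = 1] they vanish because a non-trivial
    product has a non-trivial factor. *)
Lemma prod_F10 (b : nat -> chfun F) m n x :
  (forall k, (m <= k < n)%N -> is_mchar (b k)) ->
  (m < n)%N -> chprod b m n != eps ->
  \prod_(m <= k < n) F10 (b k) x = F10 (chprod b m n) x.
Proof.
move=> hb mn hB; have hBm := chprod_mchar hb.
have [->|x0] := eqVneq x 0; first by rewrite big_ltn // !F10_0 mul0r.
rewrite [RHS]F10E // ?hB ?orbT //.
have [->|x1] := eqVneq x 1.
  rewrite subrr (mchar0 hBm) invr0.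
  have [/hasP[k]|/hasPn none] := boolP (has (fun k => b k != eps) (index_iota m n)).
    rewrite mem_index_iota => /[dup] mkn /hb hbk bk.
    rewrite (big_rem k) ?mem_index_iota //= F10E ?oner_eq0 ?bk ?orbT //.
    by rewrite subrr (mchar0 hbk) invr0 mul0r.
  case/eqP: hB; apply: mcharE => //; first exact: eps_mchar.
  move=> y y0; rewrite !ffunE (negPf y0) big_seq big1 // => k /none /negPn/eqP ->.
  by rewrite ffunE (negPf y0).
rewrite ffunE subr_eq0 eq_sym (negPf x1) -prodfV !big_nat; apply: eq_bigr => k /hb hbk.
by rewrite F10E // x1.
Qed.

(** Dividing [c (1 - t)] by [b (1 - t)] gives the kernel with lower parameter [chmul (chinv b) c];
    the constant is the ratio of the two constants in [FDkerE]. At [t = 1] both sides vanish, even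
    if [a = c]: [F10 b 1 = 0] on the left, and [b != chmul (chinv a) c] makes [FDkerE] applicable on
    the right. *)
Lemma FDker_F10 a b c t : is_mchar a -> is_mchar b -> is_mchar c -> t != 0 ->
  b != eps -> b != chmul (chinv a) c ->
  FDker a c t * F10 b t =
  gc c * g (chmul (chinv (chmul a b)) c)
    / (gc (chmul (chinv a) c) * gc (chmul (chinv b) c)) *
  FDker a (chmul (chinv b) c) t.
Proof.
move=> ha hb hc t0 b1 bac.
have hbc := chmul_mchar (chinv_mchar hb) hc.
have hac := chmul_mchar (chinv_mchar ha) hc.
have habc := chmul_mchar (chinv_mchar ha) hbc.
have aE : a != chmul (chinv b) c.
  apply: contraNneq bac => aE; apply/eqP; apply: mcharE => // x x0.
  rewrite aE !(chmulE, chinvE) invfM invrK mulfVK ?mchar_neq0 //.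
rewrite F10E ?b1 ?orbT // [FDker a (chmul _ _) t]FDkerE ?aE ?orbT //.
have -> : chmul (chinv (chmul a b)) c = chmul (chinv a) (chmul (chinv b) c).
  by apply/ffunP => x; rewrite !(chmulE, chinvE) invfM mulrA.
have abc1 : chmul (chinv a) (chmul (chinv b) c) != eps.
  apply: contraNneq aE => /ffunP E; apply/eqP; apply: mcharE => // x x0.
  have := E x; rewrite [X in X = _]chmulE [eps x]ffunE (negPf x0) chinvE.
  by move/(congr1 ( *%R (a x))); rewrite mulVKf ?mchar_neq0 // mulr1.
(* [FDkerE] produces [gc] where the claimed constant has [g]; they agree because this character is
   non-trivial. *)
rewrite (gaussc_neq_eps _ abc1).
have [t1|t1] := eqVneq t 1.
  by rewrite t1 subrr (mchar0 hb) (mchar0 hbc) invr0 !(mulr0, mul0r).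
rewrite FDkerE ?t1 // [chmul (chinv b) c (1 - t)]chmulE chinvE.
have s0 : 1 - t != 0 by rewrite subr_eq0 eq_sym.
by field; rewrite !(gaussc_neq0, gauss_neq0) ?mchar_neq0.
Qed.

(** * Lauricella functions whose last arguments coincide *)

Section CommonTail.
Variables (m n : nat) (a c : chfun F) (b : nat -> chfun F) (lam : nat -> F).
Hypotheses (ha : is_mchar a) (hc : is_mchar c) (mn : (m < n)%N).
Hypothesis hb : forall k, (k < n)%N -> is_mchar (b k).

Local Notation B := (chprod b m n).

Lemma chprod_tail_mchar : is_mchar B.
Proof. by apply: chprod_mchar => k /andP[_ /hb]. Qed.

(** The step shared by both reductions: for each [t], the factors at the common argument merge by
    [prod_F10]. *)
Lemma FD_tail x : B != eps ->
  FD psi n a b c (fun k => if (k < m)%N then lam k else x) =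
  \sum_(t | t != 0)
     FDker a c t * (\prod_(0 <= j < m) F10 (b j) (t * lam j) * F10 B (t * x)).
Proof.
move=> B1; rewrite FD_sum //; apply: eq_bigr => t t0; congr (FDker a c t * _).
rewrite (big_cat_nat _ (n := m)) ?(ltnW mn) //=; congr (_ * _).
  by apply: eq_big_nat => j /andP[_ ->].
rewrite -prod_F10 // => [|k /andP[_ /hb] //].
by apply: eq_big_nat => j /andP[mj _]; rewrite ltnNge mj.
Qed.

Lemma FD_tail_merge x : B != eps ->
  FD psi n a b c (fun k => if (k < m)%N then lam k else x) =
  FD psi m.+1 a (fun k => if (k < m)%N then b k else B) c
     (fun k => if (k < m)%N then lam k else x).
Proof.
move=> B1; rewrite FD_tail // FD_sum //; apply: eq_bigr => t t0.
congr (FDker a c t * _); rewrite big_nat_recr //= ltnn; congr (_ * _).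
by apply: eq_big_nat => j /andP[_ ->].
Qed.

(** At [x = 1] the merged factor is [F10 B t], which [FDker_F10] absorbs into the kernel; the other
    factors give the smaller [FD]. *)
Lemma FD_tail1 : B != eps -> B != chmul (chinv a) c ->
  FD psi n a b c (fun k => if (k < m)%N then lam k else 1) =
  gc c * g (chmul (chinv (chmul a B)) c)
    / (gc (chmul (chinv a) c) * gc (chmul (chinv B) c)) *
  FD psi m a b (chmul (chinv B) c) lam.
Proof.
move=> B1 Bac; have hB := chprod_tail_mchar.
rewrite FD_tail // FD_sum //; last exact: chmul_mchar (chinv_mchar hB) hc.
rewrite mulr_sumr; apply: eq_bigr => t t0.
by rewrite mulr1 mulrA mulrAC FDker_F10 // mulrA.
Qed.

End CommonTail.

End Lauricella.

Theorem theorem3p23 (F : finFieldType) (psi : F -> algC)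
  (hpsi : is_nontriv_addchar psi)
  (n i : nat) (alpha gamma : chfun F) (beta : nat -> chfun F)
  (hn : (1 <= n)%N) (hi : (i < n)%N)
  (halpha : is_mchar alpha) (hgamma : is_mchar gamma)
  (hbeta : forall k, (k < n)%N -> is_mchar (beta k)) :
  let Bi := chprod beta i n in
  let B0 := chprod beta 0 n in
  (* (i) *)
  (Bi != eps F ->
   forall (lam : nat -> F) (x : F),
     FD psi n alpha beta gamma (fun k => if (k < i)%N then lam k else x)
     = FD psi i.+1 alpha (fun k => if (k < i)%N then beta k else Bi) gamma
          (fun k => if (k < i)%N then lam k else x))
  /\
  (B0 != eps F ->
   forall x : F,
     FD psi n alpha beta gamma (fun _ => x) = F21 psi alpha B0 gamma x)
  /\
  (* (ii) *)
  (Bi != eps F -> Bi != chmul (chinv alpha) gamma ->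
   forall lam : nat -> F,
     FD psi n alpha beta gamma (fun k => if (k < i)%N then lam k else 1)
     = gaussc psi gamma * gauss psi (chmul (chinv (chmul alpha Bi)) gamma)
       / (gaussc psi (chmul (chinv alpha) gamma)
          * gaussc psi (chmul (chinv Bi) gamma))
       * FD psi i alpha beta (chmul (chinv Bi) gamma) lam)
  /\
  (B0 != eps F -> B0 != chmul (chinv alpha) gamma ->
     FD psi n alpha beta gamma (fun _ => 1)
     = gaussc psi gamma * gauss psi (chmul (chinv (chmul alpha B0)) gamma)
       / (gaussc psi (chmul (chinv alpha) gamma)
          * gaussc psi (chmul (chinv B0) gamma))).

Proof.
move=> Bi B0; split; [|split; [|split]].
- by move=> Bi1 lam x; exact: FD_tail_merge.
- move=> B01 x; rewrite F21_sum.
  (* Here [m = 0]: the untouched product is empty, leaving the integral of [F21]. *)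
  rewrite (FD_tail hpsi (fun=> x) halpha hgamma hn hbeta x B01).
  by apply: eq_bigr => t _; rewrite big_geq // mul1r.
- by move=> Bi1 Biag lam; exact: FD_tail1.
(* The added factor [1] is [FD] in zero variables, by convention. *)
- move=> B01 B0ag; rewrite -[RHS]mulr1.
  exact: (FD_tail1 hpsi (fun=> 1) halpha hgamma hn hbeta B01 B0ag).
Qed.
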